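(* Let $\ell\geq 2$ and $q\geq 2$ be integers. Then $$\mathcal{N}_{4\ell,q}^{\operatorname{hom}}:=\operatorname{cl}\left(\left\{\left(\frac{\operatorname{hom}(N_{8,q};G)}{\operatorname{hom}(N_{4,q};G)^2}, \frac{\operatorname{hom}(N_{12,q};G)}{\operatorname{hom}(N_{4,q};G)^3}, \ldots, \frac{\operatorname{hom}(N_{4\ell,q};G)}{\operatorname{hom}(N_{4,q};G)^\ell}\right) \;\middle|\; G \text{ a graph with } \operatorname{hom}(N_{4,q};G)\neq 0\right\}\right)$$ is equal to the power-sum profile $\Pi_\ell$.
   Context: Graphs are finite simple graphs. For graphs $H,G$, $\operatorname{hom}(H;G)$ is the number of maps $V(H)\to V(G)$ sending every edge of $H$ to an edge of $G$. For a graph $F$ and an integer $q\geq 3$, the $q$-ification of $F$ is the graph obtained from $F$ by adding, for every edge $\{u,v\}$ of $F$, $q-2$ new vertices which are pairwise adjacent and adjacent to both $u$ and $v$ (so each edge of $F$ is replaced by a clique of size $q$); the $2$-ification of $F$ is $F$ itself. The $q$-necklace $N_{c,q}$ is the $q$-ification of the cycle $C_c$ of length $c$ (so $N_{c,2}=C_c$). $\operatorname{cl}$ denotes topological closure in $\mathbb{R}^{\ell-1}$. For $\mathbf{x}\in\mathbb{R}^n$ and $i\in\mathbb{N}$, $p_i(\mathbf{x})=\sum_{j=1}^n x_j^i$. Let $\Pi_{n,\ell}=\{(p_2(\mathbf{x}),\ldots,p_\ell(\mathbf{x})) : \mathbf{x}\in\mathbb{R}^n_{\geq 0},\ p_1(\mathbf{x})=1\}$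 and the power-sum profile $\Pi_\ell=\operatorname{cl}\left(\bigcup_{n\in\mathbb{N}}\Pi_{n,\ell}\right)\subseteq\mathbb{R}^{\ell-1}$. *)

(* Defs.v *)
From HB Require Import structures.
From mathcomp Require Import all_boot all_order all_algebra.
From mathcomp Require Import all_classical all_reals all_analysis.

Set Implicit Arguments.
Unset Strict Implicit.
Unset Printing Implicit Defensive.

Import Order.TTheory GRing.Theory Num.Theory.
Import numFieldNormedType.Exports.

Record sgraph := SGraph {
  vertex :> finType;
  adj : rel vertex;
  adj_sym : symmetric adj;
  adj_irrefl : irreflexive adj
}.

Definition is_hom (H G : sgraph) (f : {ffun H -> G}) : bool :=
  [forall u, forall v, adj u v ==> adj (f u) (f v)].

Definition hom (H G : sgraph) : nat := #|[pred f : {ffun H -> G} | is_hom f]|.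

Section Qification.
Variables (F : sgraph) (q : nat).

Definition is_edge (A : {set F}) : bool :=
  [exists u, exists v, adj u v && (A == [set u; v]%SET)].

Definition edge : finType := {A : {set F} | is_edge A}.

(* The pair (A, i) is the i-th of the q - 2 new vertices attached to the edge
   A. For q = 2 there are none, and the graph is F up to the bijection inl. *)
Definition qif_vertex : finType := (F + edge * 'I_(q - 2))%type.

Definition qif_adj : rel qif_vertex := fun x y =>
  match x, y with
  | inl u, inl v => adj u v
  | inl u, inr (A, _) => u \in val A
  | inr (A, _), inl v => v \in val A
  | inr (A, i), inr (B, j) => (A == B) && (i != j)
  end.

Lemma qif_adj_sym : symmetric qif_adj.
Proof.
move=> [u|[A i]] [v|[B j]] //=; first exact: adj_sym.
by rewrite eq_sym [i == j]eq_sym.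
Qed.

Lemma qif_adj_irrefl : irreflexive qif_adj.
Proof. by move=> [u|[A i]] /=; rewrite ?adj_irrefl // !eqxx. Qed.

Definition qification : sgraph := SGraph qif_adj_sym qif_adj_irrefl.

End Qification.

Lemma hom_qification2 (F G : sgraph) : hom (qification F 2) G = hom F G.
Proof.
pose r (f : {ffun qification F 2 -> G}) : {ffun F -> G} := [ffun u => f (inl u)].
pose s (g : {ffun F -> G}) : {ffun qification F 2 -> G} :=
  [ffun x : qif_vertex F 2 => match x with
                              | inl u => g u
                              | inr (_, i) => False_rect _ (notF (ltn_ord i))
                              end].
have rK : cancel r s.
  by move=> f; apply/ffunP => -[u|[A [i]]] //=; rewrite !ffunE.
have sK : cancel s r by move=> g; apply/ffunP => u; rewrite !ffunE.
rewrite /hom -(on_card_preimset (f := r)); last by exists s => ? _.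
rewrite cardsE; apply: eq_card => f; rewrite !inE /is_hom.
apply/forallP/forallP => [h u|h [u|[A [i]]] //].
  by apply/forallP => v; rewrite !ffunE; exact: (forallP (h (inl u)) (inl v)).
apply/forallP => -[v|[A [i]]] //.
by have := forallP (h u) v; rewrite !ffunE.
Qed.

Section Cycle.
Variable c : nat.

(* The conjunct i != j only matters for c = 1. *)
Definition cycle_adj : rel 'I_c := fun i j =>
  (i != j) && ((j == ordS i) || (i == ordS j)).

Lemma cycle_adj_sym : symmetric cycle_adj.
Proof. by move=> i j; rewrite /cycle_adj eq_sym orbC. Qed.

Lemma cycle_adj_irrefl : irreflexive cycle_adj.
Proof. by move=> i; rewrite /cycle_adj eqxx. Qed.

Definition cycle_graph : sgraph := SGraph cycle_adj_sym cycle_adj_irrefl.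

End Cycle.

Definition necklace (c q : nat) : sgraph := qification (cycle_graph c) q.

Local Open Scope classical_set_scope.
Local Open Scope ring_scope.

Definition power_sum (R : realType) (n : nat) (x : 'rV[R]_n) (i : nat) : R :=
  \sum_(j < n) x 0 j ^+ i.

(* Coordinate i : 'I_(l - 1) of a point of R^(l-1) carries the power sum (or
   the necklace ratio) of index i + 2. *)
Definition power_sum_set (R : realType) (n l : nat) : set 'rV[R]_(l.-1) :=
  [set y | exists x : 'rV[R]_n,
     [/\ forall j, 0 <= x 0 j,
         power_sum x 1 = 1 &
         y = \row_(i < l.-1) power_sum x i.+2]].
Arguments power_sum_set : clear implicits.

Definition power_sum_profile (R : realType) (l : nat) : set 'rV[R]_(l.-1) :=
  closure (\bigcup_n power_sum_set R n l).
Arguments power_sum_profile : clear implicits.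

Definition necklace_ratios (R : realType) (l q : nat) (G : sgraph) :
    'rV[R]_(l.-1) :=
  \row_(i < l.-1) ((hom (necklace (4 * i.+2)%N q) G)%:R
                   / (hom (necklace 4 q) G)%:R ^+ i.+2).

Definition necklace_profile (R : realType) (l q : nat) : set 'rV[R]_(l.-1) :=
  closure [set y : 'rV[R]_(l.-1) | exists G : sgraph,
    hom (necklace 4 q) G <> 0%N /\ y = necklace_ratios R l q G].
Arguments necklace_profile : clear implicits.

(* Main.v *)
Require Import Defs.
From mathcomp Require Import all_boot all_order all_algebra.
From mathcomp Require Import all_classical all_reals all_analysis.
From mathcomp Require Import spectral complex zify ring.
Import Defs.

Set Implicit Arguments.
Unset Strict Implicit.
Unset Printing Implicit Defensive.

Import Order.TTheory GRing.Theory Num.Theory.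
Import numFieldNormedType.Exports.

(* Let A be the symmetric matrix on V(G) whose entry at an edge uv is the number
   of ways to extend uv to an ordered q-clique (and 0 at a non-edge). For
   c >= 3, hom(N_{c,q}; G) is the trace of A^c, that is the c-th power sum of
   the real eigenvalues d_i of A. The necklace ratios are therefore the power
   sums of the nonnegative vector d_i^4 / (sum of the d_j^4), whose entries add up to 1.

   Conversely, for the disjoint union of complete graphs K_{t_i + 1}, the
   eigenvalues of A are c_i t_i (once) and - c_i (t_i times), where
   c_i = (t_i - 1)(t_i - 2)...(t_i - q + 2). With t_i the integer part of
   N x_i^(1/(4(q-1))) the small eigenvalues are negligible as N grows, and the
   necklace ratios converge to the power sums of x. *)

(** * Homomorphism counts of q-ifications and necklaces *)

Section CliqueExtensions.
Variables (G : sgraph) (q : nat).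

(** The base is a set because edges of [F] are encoded as sets. Injectivity of [g] and disjointness
    from [S] come from irreflexivity of [adj]. *)
Definition extends_clique (S : {set G}) (g : {ffun 'I_(q - 2) -> G}) : bool :=
  [forall i, forall u in S, adj u (g i)] &&
  [forall i, forall j, (i != j) ==> adj (g i) (g j)].

Definition clique_exts (S : {set G}) : nat := #|extends_clique S|.

Definition edge_weight (u v : G) : nat :=
  adj u v * clique_exts [set u; v]%SET.

Lemma edge_weightC (u v : G) : edge_weight u v = edge_weight v u.
Proof. by rewrite /edge_weight adj_sym finset.setUC. Qed.

(** New vertices attached to different edges are non-adjacent, so once [f] is fixed on [F] the
    extensions are chosen independently edge by edge. *)
Lemma hom_qification (F : sgraph) :
  hom (qification F q) G =
  \sum_(f : {ffun F -> G} | is_hom f)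
    \prod_(A : edge F) clique_exts (f @: val A)%SET.
Proof.
pose E := edge F.
pose glue (p : {ffun F -> G} * {ffun E -> {ffun 'I_(q - 2) -> G}}) :
    {ffun qification F q -> G} :=
  [ffun x : qif_vertex F q => match x with
                              | inl u => p.1 u
                              | inr (A, i) => p.2 A i
                              end].
pose cut (h : {ffun qification F q -> G}) :
    {ffun F -> G} * {ffun E -> {ffun 'I_(q - 2) -> G}} :=
  ([ffun u => h (inl u)], [ffun A => [ffun i => h (inr (A, i))]]).
have glueK : cancel glue cut.
  move=> [f g]; rewrite /cut; congr pair.
    by apply/ffunP => u; rewrite !ffunE.
  by apply/ffunP => A; apply/ffunP => i; rewrite !ffunE.
have cutK : cancel cut glue.
  by move=> h; apply/ffunP => -[u|[A i]]; rewrite !ffunE.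
have homE f g : is_hom (glue (f, g)) =
    is_hom f && [forall A : E, extends_clique (f @: val A)%SET (g A)].
  apply/forallP/andP => [H|[/forallP H1 /forallP H2]].
    split.
      apply/forallP => u; apply/forallP => v.
      by have := forallP (H (inl u)) (inl v); rewrite !ffunE.
    apply/forallP => A; apply/andP; split; apply/forallP => i.
      apply/forallP => x; apply/implyP => /imsetP[u uA ->].
      by have := forallP (H (inl u)) (inr (A, i)); rewrite !ffunE /= uA.
    apply/forallP => j.
    by have := forallP (H (inr (A, i))) (inr (A, j)); rewrite !ffunE /= eqxx.
  have ext (A : E) (u : F) i : u \in val A -> adj (f u) (g A i).
    move=> uA; have /andP[/forallP/(_ i)/forallP/(_ (f u)) + _] := H2 A.
    by rewrite imset_f.
  move=> [u|[A i]]; apply/forallP => -[v|[B j]]; rewrite !ffunE /=.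
  - exact: (forallP (H1 u) v).
  - by apply/implyP; apply: ext.
  - by apply/implyP; rewrite adj_sym; apply: ext.
  - apply/implyP => /andP[/eqP <- ij].
    by have /andP[_ /forallP/(_ i)/forallP/(_ j)] := H2 A; rewrite ij.
rewrite /hom -sum1_card (reindex glue) /=; last first.
  by exists cut => ? _; [exact: glueK | exact: cutK].
rewrite (eq_bigl (fun p : {ffun F -> G} * {ffun E -> {ffun 'I_(q - 2) -> G}} =>
  is_hom p.1 &&
    [forall A : E, extends_clique (p.1 @: val A)%SET (p.2 A)])); last first.
  by case=> f g; rewrite inE homE.
rewrite -(pair_big_dep (fun f => is_hom f)
  (fun f (g : {ffun E -> {ffun 'I_(q - 2) -> G}}) =>
     [forall A : E, extends_clique (f @: val A)%SET (g A)])
  (fun _ _ => 1%N)) /=.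
apply: eq_bigr => f _.
(* Distributivity turns the product of cardinalities into a count of families with one extension per
   edge. *)
rewrite /clique_exts; under [RHS]eq_bigr do rewrite -sum1_card.
rewrite bigA_distr_big_dep; under [RHS]eq_bigr do rewrite big1_eq.
by apply: eq_bigl => g; apply/forallP/familyP => H A; exact: (H A).
Qed.

(** For [2 < c] the sets [{i, ordS i}] list each edge of the cycle once; for [c = 2] the two of them
    would coincide. Maps that are not homomorphisms may be included, as their product vanishes. *)
Lemma hom_necklace (c : nat) : (2 < c)%N ->
  hom (necklace c q) G =
  \sum_(f : {ffun 'I_c -> G}) \prod_i edge_weight (f i) (f (ordS i)).
Proof.
case: c => [|[|[|c]]] // _; set n := c.+3.
have ordSn (i : 'I_n) : i != ordS i.
  rewrite -val_eqE /=; have := ltn_ord i; rewrite leq_eqVlt => /orP[/eqP e|h].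
    by rewrite e modnn; case: (val i) e.
  by rewrite modn_small //; lia.
have edgeP (i : 'I_n) : is_edge (F := cycle_graph n) [set i; ordS i]%SET.
  apply/existsP; exists i; apply/existsP; exists (ordS i).
  by rewrite eqxx andbT /= /cycle_adj ordSn eqxx.
pose side (i : 'I_n) : edge (cycle_graph n) :=
  Sub [set i; ordS i]%SET (edgeP i).
have side_inj : injective side.
  move=> i j /(congr1 val) /= /setP S.
  (* If the sides at [i] and [j] agree but [i] differs from [j], then [i = ordS j] and [ordS i = j],
     so two successor steps fix [j], impossible for [n >= 3]. *)
  have := S i; rewrite !inE eqxx /= => /esym/orP[/eqP//|/eqP ij].
  have := S (ordS i); rewrite !inE eqxx orbT => /esym/orP[/eqP ji|/eqP];
    last first.
    exact: ordS_inj.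
  move: ji; rewrite ij => /(congr1 val) /=.
  have := ltn_ord j; rewrite /n leq_eqVlt => /orP[/eqP[->]|h].
    by rewrite modnn modn_small.
  rewrite (modn_small h); move: h; rewrite leq_eqVlt => /orP[/eqP[->]|h].
    by rewrite modnn.
  by rewrite modn_small //; lia.
have side_surj A : exists i, side i = A.
  case: A => A /[dup] /existsP[u /existsP[v /andP[/andP[_ uv] /eqP ->]]] p.
  case/orP: uv => /eqP e.
    by exists u; apply/val_inj; rewrite /= e.
  by exists v; apply/val_inj; rewrite /= e finset.setUC.
have side_bij : bijective side.
  apply: inj_card_bij => //; rewrite -(card_codom side_inj).
  apply/subset_leq_card/fintype.subsetP => A _.
  by have [i <-] := side_surj A; apply: codom_f.
rewrite /necklace hom_qification big_mkcond /=; apply: eq_bigr => f _.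
rewrite (reindex side) /=; last exact: onW_bij.
rewrite /edge_weight big_split /=.
case: ifPn => [/forallP H|].
  rewrite [X in (X * _)%N]big1 ?mul1n => [|i _].
    by apply: eq_bigr => i _; rewrite finset.imsetU1 imset_set1.
  by have := forallP (H i) (ordS i); rewrite /= /cycle_adj ordSn eqxx /= => ->.
(* Some side of the cycle goes to a non-edge, and its factor is 0. *)
rewrite /is_hom => /forallPn[i /forallPn[j]].
rewrite negb_imply => /andP[/andP[_ ij] nij].
rewrite (_ : \prod_i _ = 0)%N ?mul0n //.
case/orP: ij => /eqP e; subst.
  by apply/eqP; rewrite (bigD1 i) //= (negbTE nij) mul0n.
by apply/eqP; rewrite (bigD1 j) //= adj_sym (negbTE nij) mul0n.
Qed.

End CliqueExtensions.

Local Open Scope ring_scope.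

(** * Closed walks and traces of matrix powers *)

Section ClosedWalks.
Variables (R : comNzRingType) (V : finType) (w : V -> V -> R).

Fixpoint walks (k : nat) (u v : V) : R :=
  if k is k'.+1 then \sum_t w u t * walks k' t v else (u == v)%:R.

Arguments walks : simpl never.

Lemma walksS k u v : walks k.+1 u v = \sum_t w u t * walks k t v.
Proof. by []. Qed.

(** A walk is stored as its first [n] vertices; the default value [v] of [oapp] supplies its
    endpoint. *)
Let step n (f : {ffun 'I_n -> V}) (v : V) (k : nat) : V := oapp f v (insub k).

Lemma walksE n u v :
  walks n.+1 u v = \sum_(f : {ffun 'I_n.+1 -> V} | f ord0 == u)
                     \prod_i w (f i) (step f v i.+1).
Proof.
elim: n u => [|n IHn] u.
  rewrite (big_pred1 [ffun=> u]) => [|f]; last first.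
    apply/eqP/eqP => [<-|->]; last by rewrite ffunE.
    by apply/ffunP => i; rewrite ffunE ord1.
  rewrite big_ord_recl big_ord0 mulr1 ffunE /step insubF //=.
  rewrite walksS; under eq_bigr do rewrite /walks mulr_natr mulrb.
  by rewrite -big_mkcond big_pred1_eq.
pose scons (g : {ffun 'I_n.+1 -> V}) : {ffun 'I_n.+2 -> V} :=
  [ffun i => oapp g u (unlift ord0 i)].
pose stail (f : {ffun 'I_n.+2 -> V}) : {ffun 'I_n.+1 -> V} :=
  [ffun i => f (lift ord0 i)].
have scons0 g : scons g ord0 = u by rewrite ffunE unlift_none.
have sconsS g i : scons g (lift ord0 i) = g i by rewrite ffunE liftK.
have stepS g i : step (scons g) v i.+1 = step g v i.
  rewrite /step; case: insubP => [j lj jE|lj].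
    have li : (i < n.+1)%N by rewrite -ltnS.
    rewrite insubT /= -sconsS; congr (scons g _); apply/val_inj.
    by rewrite /= jE.
  by rewrite insubF //; apply/negbTE; rewrite -ltnS.
rewrite (reindex_onto scons stail) => [|f /eqP f0]; last first.
  apply/ffunP => i; case: (unliftP ord0 i) => [j ->|->].
    by rewrite sconsS ffunE.
  by rewrite scons0.
rewrite (eq_bigl predT) => [|g]; last first.
  rewrite scons0 eqxx /=; apply/eqP/ffunP => i; by rewrite ffunE sconsS.
(* With the start [u] split off, [g] is the rest of the walk; grouping by its first vertex [t]
   matches the recursion of [walks]. *)
rewrite (partition_big (fun g : {ffun 'I_n.+1 -> V} => g ord0) predT) //=.
rewrite walksS.
apply: eq_bigr => t _; rewrite IHn big_distrr /=.
apply: eq_bigr => g /eqP g0; rewrite [RHS]big_ord_recl scons0 stepS.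
rewrite (_ : step g v ord0 = t); last first.
  by rewrite /step insubT /= -g0; congr (g _); apply/val_inj.
by congr (_ * _); apply: eq_bigr => i _; rewrite sconsS stepS.
Qed.

Lemma sum_walks_closed c : (0 < c)%N ->
  \sum_(f : {ffun 'I_c -> V}) \prod_i w (f i) (f (ordS i)) =
  \sum_u walks c u u.
Proof.
case: c => // n _.
rewrite (partition_big (fun g : {ffun 'I_n.+1 -> V} => g ord0) predT) //=.
apply: eq_bigr => u _; rewrite walksE.
apply: eq_bigr => f /eqP f0; apply: eq_bigr => i _; congr w.
(* At the last index [ordS] wraps around to [ord0], where [f] takes the value [u], which is also the
   default value of [step]. *)
have := ltn_ord i; rewrite /step leq_eqVlt => /orP[/eqP e|h].
  rewrite e insubF ?ltnn //= -f0; congr (f _); apply/val_inj => /=.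
  by rewrite e modnn.
rewrite insubT /=; congr (f _); apply/val_inj => /=.
by rewrite modn_small.
Qed.

Definition weight_mx : 'M[R]_#|V| := \matrix_(i, j) w (enum_val i) (enum_val j).

Lemma weight_mxX k i j :
  (weight_mx ^+ k) i j = walks k (enum_val i) (enum_val j).
Proof.
elim: k i => [|k IHk] i.
  by rewrite expr0 mxE /walks (inj_eq enum_val_inj).
rewrite exprS mxE walksS (reindex (@enum_val V V)) /=; last first.
  by apply: onW_bij; apply: enum_val_bij.
by apply: eq_bigr => t _; rewrite IHk mxE.
Qed.

Lemma trace_weight_mxX k : \tr (weight_mx ^+ k) = \sum_u walks k u u.
Proof.
rewrite [RHS](reindex (@enum_val V V)) /=; last exact/onW_bij/enum_val_bij.
by apply: eq_bigr => i _; rewrite weight_mxX.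
Qed.

End ClosedWalks.

Arguments walks : simpl never.

Lemma hom_necklace_walks (R : comNzRingType) (G : sgraph) (q c : nat) :
  (2 < c)%N ->
  (hom (necklace c q) G)%:R =
  \sum_u walks (fun u v : G => (edge_weight q u v)%:R : R) c u u.
Proof.
move=> c2; rewrite hom_necklace // -sum_walks_closed ?(ltn_trans _ c2) //.
by rewrite natr_sum; apply: eq_bigr => f _; rewrite natr_prod.
Qed.

(** * Spectral theorem and the inclusion of necklace ratios in power sums *)

Lemma expr_conj_diag_mx (F : fieldType) n (P : 'M[F]_n) (d : 'rV_n) k :
  P \in unitmx ->
  (invmx P *m diag_mx d *m P) ^+ k =
  invmx P *m diag_mx (\row_i d 0 i ^+ k) *m P.
Proof.
move=> Pu; elim: k => [|k IHk].
  rewrite expr0 (_ : diag_mx _ = 1%:M) ?mulmx1 ?mulVmx //.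
  by apply/matrixP => i j; rewrite !mxE expr0.
rewrite exprS IHk -mulmxE !mulmxA mulmxK //; congr (_ *m _).
rewrite -!mulmxA mulmx_diag; congr (_ *m diag_mx _).
by apply/rowP => i; rewrite !mxE exprS.
Qed.

(** Over [R[i]] the matrix becomes Hermitian, hence unitarily diagonalizable with real spectrum; the
    real parts of the spectrum serve as [d], and the identity descends by injectivity of the
    embedding of [R]. *)
Lemma trace_symmetricX (R : rcfType) n (A : 'M[R]_n) : A^T = A ->
  exists d : 'I_n -> R, forall k, \tr (A ^+ k) = \sum_i d i ^+ k.
Proof.
move=> symA; pose B : 'M[R[i]]_n := map_mx (real_complex R) A.
have Bherm : B \is hermsymmx.
  apply: realsym_hermsym.
    apply/is_hermitianmxP; rewrite expr0 scale1r.
    by apply/matrixP => i j; rewrite !mxE -{1}symA mxE.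
  by apply/mxOverP => i j; rewrite mxE; apply/complex_realP; exists (A i j).
have /mxOverP dreal := hermitian_spectral_diag_real Bherm.
have /orthomx_spectralP defB := hermitian_normalmx Bherm.
set P := spectralmx B in defB; set d := spectral_diag B in defB dreal.
have Pu : P \in unitmx := spectral_unit B.
exists (fun i => complex.Re (d 0 i)) => k.
apply: (@complexI R).
rewrite -[LHS]/(real_complex R (\tr (A ^+ k))).
rewrite -trace_map_mx rmorphXn /= -/B [in LHS]defB expr_conj_diag_mx //.
rewrite mxtrace_mulC mulmxA mulmxV // mul1mx.
rewrite mxtrace_diag raddf_sum /=; apply: eq_bigr => i _.
rewrite mxE rmorphXn /=; congr (_ ^+ _).
by have /complex_realP[r ->] := dreal 0 i.
Qed.

Lemma necklace_ratios_power_sum (R : realType) (l q : nat) (G : sgraph) :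
  hom (necklace 4 q) G <> 0%N ->
  exists n, power_sum_set R n l (necklace_ratios R l q G).
Proof.
move=> hN4; pose w (u v : G) : R := (edge_weight q u v)%:R.
have symW : (weight_mx w)^T = weight_mx w.
  by apply/matrixP => i j; rewrite !mxE /w edge_weightC.
have [d trd] := trace_symmetricX symW.
have homE c : (2 < c)%N -> (hom (necklace c q) G)%:R = \sum_i d i ^+ c.
  by move=> c2; rewrite (hom_necklace_walks R) // -trace_weight_mxX trd.
set S : R := (hom (necklace 4 q) G)%:R.
have S0 : S != 0 by rewrite pnatr_eq0; apply/eqP.
have SE : S = \sum_i d i ^+ 4 by apply: homE.
have psE k : power_sum (\row_i (d i ^+ 4 / S)) k =
    (\sum_i d i ^+ (4 * k)) / S ^+ k.
  rewrite /power_sum mulr_suml; apply: eq_bigr => i _.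
  by rewrite mxE expr_div_n exprM.
exists #|G|; exists (\row_i (d i ^+ 4 / S)); split.
- move=> j; rewrite mxE mulr_ge0 ?invr_ge0 ?ler0n //.
  by rewrite (exprM _ 2 2) sqr_ge0.
- by rewrite psE muln1 expr1 -SE divff.
- by apply/rowP => i; rewrite !mxE psE homE //; lia.
Qed.

(** * Necklace counts in disjoint unions of complete graphs *)

Section CliqueUnion.
Variables (n M : nat) (t : 'I_n -> nat).

Definition clique_union_adj : rel ('I_n * 'I_M) := fun x y =>
  [&& x.1 == y.1, x.2 != y.2, (x.2 <= t x.1)%N & (y.2 <= t x.1)%N].

Lemma clique_union_adj_sym : symmetric clique_union_adj.
Proof.
move=> [i a] [j b]; rewrite /clique_union_adj /= eq_sym [b == a]eq_sym.
by case: eqP => // ->; rewrite [(a <= _)%N && _]andbC.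
Qed.

Lemma clique_union_adj_irrefl : irreflexive clique_union_adj.
Proof. by move=> x; rewrite /clique_union_adj !eqxx. Qed.

(* The disjoint union of complete graphs on t i + 1 vertices, together with
   isolated vertices. *)
Definition clique_union : sgraph :=
  SGraph clique_union_adj_sym clique_union_adj_irrefl.

Hypothesis tM : forall i, (t i < M)%N.

Lemma sum_ord_leq (R : pzSemiRingType) i (F : 'I_M -> R) :
  \sum_(a : 'I_M | (a <= t i)%N) F a =
  \sum_(a < (t i).+1) F (widen_ord (tM i) a).
Proof. by rewrite -(big_ord_narrow (tM i)). Qed.

(** Extensions of an edge are the injections of ['I_(q - 2)] into the other [t i + 1 - 2] vertices
    of its clique, which a falling factorial counts. *)
Lemma clique_union_weight (q : nat) (x y : clique_union) :
  edge_weight q x y = (adj x y * (t x.1).-1 ^_ (q - 2))%N.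
Proof.
rewrite /edge_weight; case: (boolP (adj x y)) => //; rewrite !mul1n.
case: x y => [i a] [j b] /and4P[/= /eqP <- nab ai bi].
pose S : {set clique_union} :=
  [set z : clique_union |
    [&& z.1 == i, z.2 != a, z.2 != b & (z.2 <= t i)%N]]%SET.
have cardS : #|S| = (t i).-1.
  pose T : {set 'I_M} := [set c : 'I_M | (c <= t i)%N]%SET.
  have cardT : #|T| = (t i).+1.
    rewrite -sum1_card; under eq_bigl do rewrite inE.
    by rewrite sum_ord_leq sum1_card card_ord.
  have -> : S = [set (i, c) | c in T :\ a :\ b]%SET.
    apply/setP => -[i' c]; rewrite !inE /=; apply/and4P/imsetP.
      move=> [/eqP -> ca cb ci]; exists c => //.
      by rewrite !inE ca cb ci.
    by move=> [c']; rewrite !inE => /and3P[cb ca ci] [-> ->].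
  rewrite card_imset => [|c c' []//].
  have := cardsD1 a T; have := cardsD1 b (T :\ a)%SET.
  by rewrite cardT !inE [b == a]eq_sym nab ai bi /= => -> [->].
rewrite -cardS -[in RHS](card_ord (q - 2)) -card_inj_ffuns_on.
apply: eq_card => g; rewrite !inE.
apply/andP/andP => [[/forallP H1 /forallP H2]|[/ffun_onP H1 /injectiveP H2]].
  split.
    apply/ffun_onP => k; rewrite inE.
    have /forallP H := H1 k; have := H (i, a); have := H (i, b).
    rewrite !inE !eqxx orbT /= => /and4P[/= /eqP -> bk _ ->].
    move=> /and4P[/= _ ak _ _].
    by rewrite eqxx eq_sym ak eq_sym bk.
  apply/injectiveP => k k' e; apply/eqP; apply: contraT => kk'.
  by have := forallP (H2 k) k'; rewrite kk' e adj_irrefl.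
have H k : [/\ (g k).1 = i, (g k).2 != a, (g k).2 != b & ((g k).2 <= t i)%N].
  by have := H1 k; rewrite inE => /and4P[/eqP].
split; apply/forallP => k.
  apply/forallP => z; apply/implyP; have [gi ga gb gt] := H k.
  rewrite !inE => /orP[] /eqP -> /=.
    by rewrite /clique_union_adj /= gi eqxx eq_sym ga ai gt.
  by rewrite /clique_union_adj /= gi eqxx eq_sym gb bi gt.
apply/forallP => k'; apply/implyP => kk'.
have [gi ga gb gt] := H k; have [gi' ga' gb' gt'] := H k'.
rewrite /= /clique_union_adj gi gi' eqxx gt gt' !andbT /=.
apply: contra kk' => /eqP e; apply/eqP; apply: H2.
by rewrite [LHS]surjective_pairing [RHS]surjective_pairing gi gi' e.
Qed.

Variables (R : numDomainType) (q : nat).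

Let w (x y : clique_union) : R := (edge_weight q x y)%:R.
Let s i : R := (t i)%:R.
Let c i : R := ((t i).-1 ^_ (q - 2))%:R.

(* The all-ones matrix J of a clique satisfies J (J - 1) = t J, whence
   (t + 1) (J - 1)^k = (t^k - (-1)^k) J + (t + 1) (-1)^k; the factor t + 1
   avoids a division. *)
Lemma walks_clique_union k x y :
  (s x.1 + 1) * walks w k.+1 x y =
  [&& x.1 == y.1, (x.2 <= t x.1)%N & (y.2 <= t x.1)%N]%:R * c x.1 ^+ k.+1 *
  (s x.1 ^+ k.+1 - (- 1) ^+ k.+1 +
   (s x.1 + 1) * (- 1) ^+ k.+1 * (x.2 == y.2)%:R).
Proof.
case: x y => i a [j b] /=.
have wE i' a' j' b' : w (i', a') (j', b') =
    (i' == j')%:R * (a' != b')%:R * (a' <= t i')%N%:R *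
    (b' <= t i')%N%:R * c i'.
  by rewrite /w clique_union_weight natrM /= -!mulnb !natrM !mulrA.
elim: k a => [|k IHk] a.
  rewrite walksS (bigD1 (j, b)) //= [walks w 0 _ _]/walks eqxx.
  rewrite big1 => [|z /negbTE nz]; last by rewrite /walks nz mulr0.
  rewrite addr0 mulr1 wE -!mulnb !natrM; case: (a == b) => /=; ring.
have -> : walks w k.+2 (i, a) (j, b) =
    \sum_i' \sum_a' w (i, a) (i', a') * walks w k.+1 (i', a') (j, b).
  by rewrite walksS pair_bigA; apply: eq_bigr => -[].
(* Only intermediate vertices in the component of the start contribute. *)
rewrite (bigD1 i) //= [X in _ * (_ + X) = _]big1 => [|i' ni']; last first.
  rewrite big1 // => a' _; by rewrite wE [i == i']eq_sym (negbTE ni') !mul0r.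
rewrite addr0 mulr_sumr.
set P := s i ^+ k.+1 - (- 1) ^+ k.+1; set Q := (s i + 1) * (- 1) ^+ k.+1.
set K := [&& i == j, (a <= t i)%N & (b <= t i)%N].
transitivity (K%:R * c i ^+ k.+2 *
    \sum_(a' < M | (a' <= t i)%N) (a != a')%:R * (P + Q * (a' == b)%:R)).
  rewrite [in RHS]big_mkcond mulr_sumr; apply: eq_bigr => a' _.
  rewrite mulrCA IHk -/P -/Q wE eqxx /K -!mulnb !natrM [c i ^+ k.+2]exprS.
  case: (a' <= t i)%N => /=; ring.
rewrite /K; have [/eqP _|_] := boolP (i == j); last by rewrite !mul0r.
have [ai|_] := boolP (a <= t i)%N; last by rewrite !mul0r.
have [bi|_] := boolP (b <= t i)%N; last by rewrite !mul0r.
rewrite !mul1r; congr (_ * _).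
(* The sum over [a'] different from [a] is the full sum over the clique, equal to
   [(t i + 1) * P + Q], minus the term at [a]. *)
have -> : \sum_(a' < M | (a' <= t i)%N) (a != a')%:R * (P + Q * (a' == b)%:R) =
    \sum_(a' < M | (a' <= t i)%N) (P + Q * (a' == b)%:R) -
    (P + Q * (a == b)%:R).
  rewrite (bigD1 a) //= eqxx mul0r add0r [in RHS](bigD1 a) //=.
  rewrite [RHS]addrAC subrr add0r.
  by apply: eq_bigr => a' /andP[_]; rewrite eq_sym => ->; rewrite mul1r.
rewrite big_split /= (sum_ord_leq i (fun=> P)) sumr_const card_ord.
rewrite (bigD1 b) //= eqxx big1 => [|a' /andP[_ /negbTE ->]];
  last by rewrite mulr0.
rewrite -mulr_natr -natr1 -/(s i) /P /Q !exprS; case: (a == b) => /=; ring.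
Qed.

(** The trace over one clique: up to the factor [c i], the adjacency eigenvalues are [t i] once and
    -1 with multiplicity [t i]. *)
Lemma hom_necklace_clique_union k : (2 < k)%N ->
  (hom (necklace k q) clique_union)%:R =
  \sum_i c i ^+ k * (s i ^+ k + (- 1) ^+ k * s i) :> R.
Proof.
case: k => // k k2; rewrite (hom_necklace_walks R) // -/w.
transitivity (\sum_i \sum_a walks w k.+1 (i, a) (i, a)).
  by rewrite [RHS]pair_bigA; apply: eq_bigr => -[].
apply: eq_bigr => i _.
have s1 : s i + 1 != 0 by rewrite natr1 pnatr_eq0.
(* Multiplied by [s i + 1], each of the [t i + 1] clique vertices contributes the same [D] and the
   isolated ones 0, so the factor cancels against the number of vertices. *)
apply: (mulfI s1); rewrite mulr_sumr.
pose D := c i ^+ k.+1 * (s i ^+ k.+1 + (- 1) ^+ k.+1 * s i).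
rewrite (eq_bigr (fun a : 'I_M => if (a <= t i)%N then D else 0)) => [|a _].
  rewrite -big_mkcond (sum_ord_leq i (fun=> D)).
  by rewrite sumr_const card_ord -mulr_natl -natr1.
rewrite (walks_clique_union k (i, a)) /= !eqxx /= andbb /D.
case: (a <= t i)%N => /=; ring.
Qed.

End CliqueUnion.

(** * Limits of rescaled integer parts, and closures *)

Local Open Scope classical_set_scope.

Lemma cvg_truncn_sub (R : realType) (y : R) (a : nat) : 0 <= y ->
  ((Num.truncn (k.+1%:R * y) - a)%N%:R / k.+1%:R) @[k --> \oo] --> y.
Proof.
move=> y0.
(* The numerator loses at most 1 to truncation and [a] to subtraction, hence the constant [a.+1] in
   the lower bound. *)
apply: (@squeeze_cvgr _ _ _ _ (fun k => y - a.+1%:R * harmonic k) (fun=> y)).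
- near=> k; set t := Num.truncn _; have K0 : 0 < k.+1%:R :> R by rewrite ltr0n.
  have /andP[tl tu] := truncn_itv (mulr_ge0 (ltW K0) y0); rewrite -/t in tl tu.
  rewrite ler_pdivrMr // ler_pdivlMr // mulrBl -mulrA.
  rewrite /harmonic /= mulVf ?gt_eqF //.
  rewrite mulr1 mulrC lerBlDr -natrD; apply/andP; split.
    by rewrite (le_trans (ltW tu)) // ler_nat; lia.
  by rewrite (le_trans _ tl) // ler_nat leq_subr.
- rewrite -[X in _ --> X]subr0 -[X in _ - X](mulr0 a.+1%:R).
  apply: cvgB; first exact: cvg_cst.
  by apply: cvgM; [exact: cvg_cst | exact: cvg_harmonic].
- exact: cvg_cst.
Unshelve. all: by end_near. Qed.

(** Each of the [r] factors of the falling factorial is the integer part minus a constant, so after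
    division by [k.+1] it tends to [y]. *)
Lemma cvg_truncn_ffact (R : realType) (y : R) (r : nat) : 0 <= y ->
  (((Num.truncn (k.+1%:R * y)).-1 ^_ r)%:R / k.+1%:R ^+ r) @[k --> \oo]
  --> y ^+ r.
Proof.
move=> y0; elim: r => [|r IHr].
  by under eq_fun do rewrite ffactn0 expr0 divr1; exact: cvg_cst.
pose t k := Num.truncn (k.+1%:R * y).
have tE k : ((t k).-1 ^_ r.+1)%:R / k.+1%:R ^+ r.+1 =
    ((t k).-1 ^_ r)%:R / k.+1%:R ^+ r * ((t k - r.+1)%N%:R / k.+1%:R) :> R.
  rewrite ffactnSr natrM exprSr invfM mulrACA; congr (_ * (_%:R / _)).
  by lia.
rewrite exprSr (eq_cvg _ _ tE); apply: cvgM IHr _.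
exact: cvg_truncn_sub.
Qed.

Lemma powR_root (R : realType) (x : R) (m : nat) : 0 <= x -> (0 < m)%N ->
  (x `^ m%:R^-1) ^+ m = x.
Proof.
move=> x0 m0; rewrite -powR_mulrn ?powR_ge0 // -powRrM mulVf ?powRr1 //.
by rewrite pnatr_eq0 -lt0n.
Qed.

(** There are finitely many coordinates, so coordinatewise convergence is uniform. Membership is
    asked only eventually, since early clique unions may have no homomorphism from the necklace. *)
Lemma closure_row_cvg (R : realType) n (A : set 'rV[R]_n) (y : 'rV[R]_n)
    (u : nat -> 'rV[R]_n) :
  (forall i, u k 0 i @[k --> \oo] --> y 0 i) ->
  (\forall k \near \oo, A (u k)) ->
  closure A y.
Proof.
move=> uy uA B /nbhs_ballP[e /= e0 yB].
have : \forall k \near \oo, forall i, ball (y 0 i) e (u k 0 i).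
  apply: filter_forall => i; exact: (cvg_ball (uy i)).
move=> /(filterI uA)/filter_ex[k [Auk buk]].
by exists (u k); split => //; apply: yB; split => // i j; rewrite ord1.
Qed.

Lemma cvgX (R : realType) (f : nat -> R) (a : R) m :
  f k @[k --> \oo] --> a -> f k ^+ m @[k --> \oo] --> a ^+ m.
Proof. by move=> fa; exact: (cvg_comp _ _ fa (@exprn_continuous R m a)). Qed.

(** * Clique unions approximating a given power-sum vector *)

Section Approximation.
Variables (R : realType) (n r : nat) (y : 'I_n -> R).
Hypothesis y_ge0 : forall i, 0 <= y i.

Definition scaled_sizes (k : nat) (i : 'I_n) : nat :=
  Num.truncn (k.+1%:R * y i).

Definition scaled_cliques (k : nat) : sgraph :=
  clique_union (\max_i scaled_sizes k i).+1 (scaled_sizes k).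

(** Here [r] is q - 2. The weight grows like [(k.+1 * y i) ^+ r] and the clique size like
    [k.+1 * y i], which gives the normalizing exponent [4 * r.+1 * e]. *)
Lemma cvg_hom_scaled_cliques (e : nat) : (0 < e)%N ->
  ((hom (necklace (4 * e) r.+2) (scaled_cliques k))%:R /
     k.+1%:R ^+ (4 * r.+1 * e)) @[k --> \oo] -->
  \sum_i (y i ^+ (4 * r.+1)) ^+ e.
Proof.
move=> e0; pose t k i := scaled_sizes k i.
(* The eigenvalues from -1 carry a factor [harmonic k ^+ (4 * e).-1], which tends to 0. The
   subtraction of 0 fits [cvg_truncn_sub] with [a = 0]. *)
have homE k : (hom (necklace (4 * e) r.+2) (scaled_cliques k))%:R /
     k.+1%:R ^+ (4 * r.+1 * e) = \sum_i
     (((t k i).-1 ^_ r)%:R / k.+1%:R ^+ r) ^+ (4 * e) *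
     (((t k i - 0)%N%:R / k.+1%:R) ^+ (4 * e) +
      ((t k i - 0)%N%:R / k.+1%:R) * harmonic k ^+ (4 * e).-1) :> R.
  rewrite hom_necklace_clique_union; last lia; last first.
    by move=> i; rewrite ltnS; exact: leq_bigmax.
  rewrite mulr_suml; apply: eq_bigr => i _.
  have sgn : (-1) ^+ (4 * e) = 1 :> R by rewrite -signr_odd oddM.
  rewrite subn2 subn0 sgn mul1r.
  rewrite -/(t k i) /harmonic /=.
  have K0 : k.+1%:R != 0 :> R by rewrite pnatr_eq0.
  have -> : (4 * r.+1 * e = r * (4 * e) + 4 * e)%N by lia.
  rewrite exprD invfM !expr_div_n -!exprM mulrACA; congr (_ * _).
  rewrite mulrDl; congr (_ + _).
  rewrite -mulrA exprVn -invfM -exprS prednK //; lia.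
rewrite (eq_cvg _ _ homE).
have -> : \sum_i (y i ^+ (4 * r.+1)) ^+ e = \sum_i
    (y i ^+ r) ^+ (4 * e) * (y i ^+ (4 * e) + y i * 0 ^+ (4 * e).-1).
  apply: eq_bigr => i _; rewrite expr0n.
  rewrite (_ : ((4 * e).-1 == 0)%N = false); last by lia.
  by rewrite mulr0 addr0 -!exprM -exprD; congr (_ ^+ _); lia.
apply: cvg_big => [|i _]; first exact: add_continuous.
have ty := cvg_truncn_sub 0 (y_ge0 i).
apply: cvgM; first exact/cvgX/cvg_truncn_ffact.
by apply: cvgD; [exact: cvgX | apply: cvgM => //; exact/cvgX/cvg_harmonic].
Qed.

End Approximation.

Lemma power_sum_necklace_profile (R : realType) (l q n : nat) : (2 <= q)%N ->
  power_sum_set R n l `<=` necklace_profile R l q.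
Proof.
case: q => [|[|r]] // _ _ [x [x0 x1 ->]].
(* The root is chosen so that [y i ^+ (4 * r.+1)] is [x 0 i]. *)
pose y i := x 0 i `^ (4 * r.+1)%:R^-1.
have y0 i : 0 <= y i by exact: powR_ge0.
have yx e : (0 < e)%N ->
    ((hom (necklace (4 * e) r.+2) (scaled_cliques y k))%:R /
     k.+1%:R ^+ (4 * r.+1 * e)) @[k --> \oo] --> power_sum x e.
  move=> e0; have := @cvg_hom_scaled_cliques _ _ r _ y0 _ e0.
  rewrite /power_sum; under eq_bigr do rewrite powR_root //.
  exact.
have yx1 := yx 1%N isT; rewrite x1 in yx1.
apply: (@closure_row_cvg _ _ _ _
  (fun k => necklace_ratios R l r.+2 (scaled_cliques y k))).
  move=> i; rewrite mxE.
  (* The powers of [k.+1] cancel in the ratio, and the normalized denominator tends to a power of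
     [power_sum x 1 = 1]. *)
  have ratioE k : necklace_ratios R l r.+2 (scaled_cliques y k) 0 i =
     ((hom (necklace (4 * i.+2) r.+2) (scaled_cliques y k))%:R /
        k.+1%:R ^+ (4 * r.+1 * i.+2)) *
     (((hom (necklace (4 * 1) r.+2) (scaled_cliques y k))%:R /
        k.+1%:R ^+ (4 * r.+1 * 1)) ^+ i.+2)^-1.
    have K0 : k.+1%:R != 0 :> R by rewrite pnatr_eq0.
    by rewrite mxE expr_div_n -exprM !muln1 invf_div mulrA divfK // expf_neq0.
  have -> : power_sum x i.+2 = power_sum x i.+2 / 1 ^+ i.+2.
    by rewrite expr1n divr1.
  rewrite (eq_cvg _ _ ratioE).
  apply: cvgM; first exact: yx.
  apply: cvgV; first by rewrite expr1n oner_eq0.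
  exact: cvgX.
(* The normalized count for the 4-necklace tends to 1, so it is eventually nonzero and the ratios
   are admissible. *)
have : \forall k \near \oo,
    (hom (necklace (4 * 1) r.+2) (scaled_cliques y k))%:R /
     k.+1%:R ^+ (4 * r.+1 * 1) != 0 :> R.
  by apply: cvgr_neq0 yx1 _; rewrite oner_eq0.
apply: filterS => k; rewrite mulf_eq0 negb_or pnatr_eq0 => /andP[/eqP h _].
by exists (scaled_cliques y k).
Qed.

Theorem theorem3p7 (R : realType) (l q : nat) (hl : (2 <= l)%N) (hq : (2 <= q)%N) :
  necklace_profile R l q = power_sum_profile R l.
Proof.
apply/seteqP; split.
  apply: closureS => _ [G [hG ->]].
  by have [n] := necklace_ratios_power_sum R l hG; exists n.
(* A closed set is its own closure, so it is enough to include the power sums before taking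
   closures. *)
rewrite [X in _ `<=` X](closure_id _).1; last exact: closed_closure.
by apply: closureS => z [n _]; exact: power_sum_necklace_profile.
Qed.
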